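(* Let $X=\ell_1^n$, let $Y$ be a real Banach space and let $Z$ be a closed subspace of $Y$. Assume that each non-zero element of $Y$ is a multi-smooth point of finite order. Suppose that $\mathcal{L}(X,Z)$ is a proximinal subspace of $\mathcal{L}(X,Y)$. Then $Z$ is a proximinal subspace of $Y$.
   Context: All Banach spaces are real; $\ell_1^n$ is $\mathbb{R}^n$ with the $\ell_1$-norm. $\mathcal{L}(X,Y)$ is the space of bounded linear operators with the operator norm, and $\mathcal{L}(X,Z)$ is regarded as a subspace of it. A non-zero element $y\in Y$ is a multi-smooth point of finite order if the linear span of $J(y)=\{y^*\in Y^*:\|y^*\|=1,\ y^*(y)=\|y\|\}$ is finite-dimensional. A subspace $W$ of a normed space $V$ is proximinal in $V$ if for every $v\in V$ there is $w_0\in W$ with $\|v-w_0\|=d(v,W)=\inf_{w\in W}\|v-w\|$. *)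

(* Defs.v *)
From HB Require Import structures.
From mathcomp Require Import all_boot all_order all_algebra.
From mathcomp Require Import all_classical all_reals all_analysis.

Set Implicit Arguments.
Unset Strict Implicit.
Unset Printing Implicit Defensive.

Import Order.TTheory GRing.Theory Num.Theory.
Import numFieldNormedType.Exports.

Local Open Scope classical_set_scope.
Local Open Scope ring_scope.

(* An alias is needed: the library equips 'rV[R]_n itself with the sup norm. *)
Definition l1 (R : realType) (n : nat) : Type := 'rV[R]_n.

Section l1_normed.
Context (R : realType) (n : nat).

HB.instance Definition _ := GRing.Lmodule.copy (l1 R n) 'rV[R]_n.

Definition l1_norm (x : l1 R n) : R := \sum_(i < n) `|(x : 'rV[R]_n) 0 i|.

Let l1_normD (x y : l1 R n) : l1_norm (x + y) <= l1_norm x + l1_norm y.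
Proof.
rewrite /l1_norm -big_split/=; apply: ler_sum => i _.
by rewrite mxE ler_normD.
Qed.

Let l1_normZ (a : R) (x : l1 R n) : l1_norm (a *: x) = `|a| * l1_norm x.
Proof.
by rewrite /l1_norm mulr_sumr; apply: eq_bigr => i _; rewrite mxE normrM.
Qed.

Let l1_norm0_eq0 (x : l1 R n) : l1_norm x = 0 -> x = 0.
Proof.
move=> /psumr_eq0P x0; apply/rowP => i; rewrite mxE; apply/normr0_eq0.
exact: x0.
Qed.

HB.instance Definition _ :=
  Lmodule_isNormed.Build R (l1 R n) l1_normD l1_normZ l1_norm0_eq0.

End l1_normed.

Section bounded_operators.
Context (R : realType) (V W : normedModType R).

Definition bounded_linear (f : V -> W) : Prop :=
  linear f /\ exists M : R, forall x, `|f x| <= M * `|x|.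

Definition boplin : {pred V -> W} := [pred f | `[< bounded_linear f >]].

Let boplin_submod : submod_closed boplin.
Proof.
split.
  apply/asboolP; split; first by move=> a x y; rewrite scaler0 addr0.
  by exists 0 => x; rewrite normr0 mul0r.
move=> a f g /asboolP[lf [M Mf]] /asboolP[lg [N Ng]]; apply/asboolP; split.
  move=> b x y /=.
  change (a *: f (b *: x + y) + g (b *: x + y) =
    b *: (a *: f x + g x) + (a *: f y + g y)).
  by rewrite lf lg !scalerDr !scalerA [b * a]mulrC addrACA.
exists (`|a| * M + N) => x; change (`|a *: f x + g x| <= (`|a| * M + N) * `|x|).
rewrite (le_trans (ler_normD _ _))// normrZ mulrDl lerD// -mulrA.
by rewrite ler_wpM2l.
Qed.

HB.instance Definition _ :=
  GRing.isSubmodClosed.Build R (V -> W) boplin boplin_submod.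

(* The space L(V, W). *)
Record bop : Type := Bop { bop_fun :> V -> W ; bopP : bop_fun \in boplin }.

HB.instance Definition _ := [isSub for bop_fun].
HB.instance Definition _ := [Choice of bop by <:].
HB.instance Definition _ := [SubChoice_isSubLmodule of bop by <:].

Definition op_norm (f : bop) : R :=
  sup [set `|f x| | x in [set x | `|x| <= 1]].

Lemma bop_linear (f : bop) : linear f.
Proof. by have /asboolP[] := bopP f. Qed.

Lemma bop_bounded (f : bop) : exists M : R, forall x, `|f x| <= M * `|x|.
Proof. by have /asboolP[] := bopP f. Qed.

Lemma bopZ (f : bop) (a : R) (x : V) : f (a *: x) = a *: f x.
Proof.
have f0 : f 0 = 0.
  have := bop_linear f 1 0 0; rewrite !scale1r addr0 => /esym/eqP.
  by rewrite -subr_eq0 addrK => /eqP.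
by have := bop_linear f a x 0; rewrite !addr0 f0 addr0.
Qed.

Lemma op_norm_has_sup (f : bop) :
  has_sup [set `|f x| | x in [set x | `|x| <= 1]].
Proof.
split; first by exists `|f 0|, 0 => //=; rewrite normr0.
have [M fM] := bop_bounded f; exists `|M| => _ [x /= x1 <-].
rewrite (le_trans (fM x))// (le_trans (ler_norm _))// normrM normr_id.
by rewrite ler_piMr.
Qed.

Lemma op_norm_ub (f : bop) (x : V) : `|x| <= 1 -> `|f x| <= op_norm f.
Proof. by move=> x1; apply: (sup_upper_bound (op_norm_has_sup f)); exists x. Qed.

Lemma op_norm_le (f : bop) (M : R) :
  (forall x, `|x| <= 1 -> `|f x| <= M) -> op_norm f <= M.
Proof.
move=> fM; apply: ge_sup; first by have [] := op_norm_has_sup f.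
by move=> _ [x /= x1 <-]; exact: fM.
Qed.

Lemma op_norm_apply (f : bop) (x : V) : `|f x| <= op_norm f * `|x|.
Proof.
have [->|x0] := eqVneq x 0.
  by have := bopZ f 0 0; rewrite !scale0r => ->; rewrite !normr0 mulr0.
have xgt0 : 0 < `|x| by rewrite normr_gt0.
have : `|f (`|x|^-1 *: x)| <= op_norm f.
  by apply: op_norm_ub; rewrite normrZ normfV normr_id mulVf// gt_eqF.
by rewrite bopZ normrZ normfV normr_id mulrC ler_pdivrMr.
Qed.

Let op_normD (f g : bop) : op_norm (f + g) <= op_norm f + op_norm g.
Proof.
apply: op_norm_le => x x1; change (`|f x + g x| <= op_norm f + op_norm g).
by rewrite (le_trans (ler_normD _ _))// lerD// op_norm_ub.
Qed.

Let op_normZ_le (a : R) (f : bop) : op_norm (a *: f) <= `|a| * op_norm f.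
Proof.
apply: op_norm_le => x x1; change (`|a *: f x| <= `|a| * op_norm f).
by rewrite normrZ ler_wpM2l// op_norm_ub.
Qed.

Let op_normZ (a : R) (f : bop) : op_norm (a *: f) = `|a| * op_norm f.
Proof.
apply/eqP; rewrite eq_le op_normZ_le/=.
have [->|a0] := eqVneq a 0.
  rewrite normr0 mul0r scale0r.
  by rewrite (le_trans (normr_ge0 ((0 : bop) 0)))// op_norm_ub// normr0.
have := op_normZ_le a^-1 (a *: f); rewrite scalerA mulVf// scale1r normfV.
by rewrite mulrC ler_pdivlMr ?normr_gt0// mulrC.
Qed.

Let op_norm0_eq0 (f : bop) : op_norm f = 0 -> f = 0.
Proof.
move=> f0; apply/val_inj/funext => x; apply/normr0_eq0/eqP.
by rewrite eq_le normr_ge0 andbT (le_trans (op_norm_apply f x))// f0 mul0r.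
Qed.

HB.instance Definition _ :=
  Lmodule_isNormed.Build R bop op_normD op_normZ op_norm0_eq0.

End bounded_operators.

(* L(X, Z) as a subset of L(X, Y), for Z a subspace of Y. *)
Definition bop_into (R : realType) (X Y : normedModType R) (Z : set Y) :
  set (bop X Y) := [set T | forall x, Z (T x)].

Lemma bop_into_submod (R : realType) (X Y : normedModType R) (Z : set Y) :
  submod_closed [in Z] -> submod_closed [in @bop_into R X Y Z].
Proof.
move=> [Z0 ZD]; split; rewrite ?inE; first by move=> x; rewrite inE in Z0.
move=> a f g; rewrite !inE => Zf Zg x; change (Z (a *: f x + g x)).
by have := ZD a (f x) (g x); rewrite !inE; apply.
Qed.

(* J(y); the dual space Y^* is bop Y R^o. *)
Definition support_functionals (R : realType) (Y : normedModType R) (y : Y) :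
  set (bop Y R^o) := [set f : bop Y R^o | `|f| = 1 /\ f y = `|y|].

Definition lin_span (R : realType) (V : lmodType R) (A : set V) : set V :=
  [set v | exists (k : nat) (c : 'I_k -> R) (e : 'I_k -> V),
     (forall i, A (e i)) /\ v = \sum_(i < k) c i *: e i].

Definition finite_dim (R : realType) (V : lmodType R) (S : set V) : Prop :=
  exists2 B : set V, finite_set B & S = lin_span B.

Definition multi_smooth_finite_order (R : realType) (Y : normedModType R)
  (y : Y) : Prop := y != 0 /\ finite_dim (lin_span (support_functionals y)).

Definition dist_to (R : realType) (V : normedModType R) (v : V) (W : set V) : R :=
  inf [set `|v - w| | w in W].

Definition proximinal (R : realType) (V : normedModType R) (W : set V) : Prop :=
  forall v : V, exists2 w0, W w0 & `|v - w0| = dist_to v W.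

(* Main.v *)
Require Import Defs.
From mathcomp Require Import all_boot all_order all_algebra.
From mathcomp Require Import all_classical all_reals all_analysis.
Import Order.TTheory GRing.Theory Num.Theory.
Import numFieldNormedType.Exports.
Local Open Scope classical_set_scope.
Local Open Scope ring_scope.

(** Let [f] be a norm-one functional on [X] attaining its norm at a unit
    vector [e], and write [f (x) z] for the rank-one operator
    [x |-> f x *: z].  The map [z |-> f (x) z] embeds [Y] isometrically into
    [L(X, Y)] and sends [Z] into [L(X, Z)], while evaluation at [e] is a
    contraction [L(X, Y) -> Y] that sends [L(X, Z)] into [Z] and inverts the
    embedding.  So [Z] inherits proximinality from [L(X, Z)]: to approximate
    [y], evaluate at [e] a best approximation [S] of [f (x) y], since
    [|y - S e| <= |f (x) y - S| <= |f (x) (y - z)| <= |y - z|] for every [z]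
    in [Z]; this is [proximinal_bop_into].  On [l_1^n] with [n > 0], take for
    [f] a coordinate and for [e] the matching basis vector. *)

(** Turns proximinality into pointwise inequalities; the infimum is harmless
    because the set of distances is bounded below by 0, and [W] is nonempty
    because it contains the minimizer. *)
Lemma dist_toP {R : realType} {V : normedModType R} {v w0 : V} {W : set V} :
  W w0 ->
  `|v - w0| = dist_to v W <-> forall w, W w -> `|v - w0| <= `|v - w|.
Proof.
move=> Ww0.
have lb0 : has_lbound [set `|v - w| | w in W].
  by exists 0 => _ [w _ <-]; exact: normr_ge0.
split=> [-> w Ww|min_w0]; first by apply: ge_inf => //; exists w.
apply/eqP; rewrite eq_le; apply/andP; split.
  apply: lb_le_inf; first by exists `|v - w0|, w0.
  by move=> _ [w Ww <-]; exact: min_w0.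
by apply: ge_inf => //; exists w0.
Qed.

Section rank_one.
Context {R : realType} {X Y : normedModType R} {f : X -> R}
  (f_lin : linear (f : X -> R^o)) (f_le : forall x, `|f x| <= `|x|).

Lemma rank_one_boplin (z : Y) : (fun x => f x *: z) \in @boplin R X Y.
Proof.
apply/asboolP; split=> [a x y|]; first by rewrite f_lin scalerDl scalerA.
by exists `|z| => x; rewrite normrZ mulrC ler_wpM2l.
Qed.

Definition rank_one (z : Y) : bop X Y := Bop (rank_one_boplin z).

Lemma rank_one_sub_le (y z : Y) : `|rank_one y - rank_one z| <= `|y - z|.
Proof.
apply: op_norm_le => x x1; change (`|f x *: y - f x *: z| <= `|y - z|).
by rewrite -scalerBr normrZ ler_piMl// (le_trans (f_le x)).
Qed.

Lemma proximinal_bop_into (Z : set Y) {e : X} :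
  submod_closed [in Z] -> `|e| <= 1 -> f e = 1 ->
  proximinal (@bop_into R X Y Z) -> proximinal Z.
Proof.
move=> [/set_mem Z0 ZD] e1 fe1 proxL y.
have ZZ a z : Z z -> Z (a *: z).
  move=> Zz; have := ZD a z 0 (mem_set Zz) (mem_set Z0).
  by rewrite addr0 => /set_mem.
have [S ZS /(dist_toP ZS) S_min] := proxL (rank_one y).
exists (S e); first exact: ZS.
apply/(dist_toP (ZS e)) => z Zz.
have ZTz : bop_into Z (rank_one z) by move=> x; exact: ZZ.
apply: le_trans (rank_one_sub_le y z); apply: le_trans (S_min _ ZTz).
have := op_norm_ub (rank_one y - S) e1.
change (`|f e *: y - S e| <= `|rank_one y - S| ->
  `|y - S e| <= `|rank_one y - S|).
by rewrite fe1 scale1r.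
Qed.

End rank_one.

Lemma l1_coord_le (R : realType) (n : nat) (i : 'I_n) (x : l1 R n) :
  `|(x : 'rV[R]_n) 0 i| <= `|x|.
Proof.
change (`|(x : 'rV[R]_n) 0 i| <= \sum_(j < n) `|(x : 'rV[R]_n) 0 j|).
by rewrite (bigD1 i)//= lerDl sumr_ge0.
Qed.

Lemma l1_norm_delta (R : realType) (n : nat) (i : 'I_n) :
  `|(delta_mx 0 i : 'rV[R]_n) : l1 R n| = 1.
Proof.
change (\sum_(j < n) `|(delta_mx 0 i : 'rV[R]_n) 0 j| = 1).
rewrite (bigD1 i)//= big1 ?addr0 => [|j /negPf ji]; last first.
  by rewrite mxE ji andbF normr0.
by rewrite mxE !eqxx normr1.
Qed.

Theorem corollary2p11 (R : realType) (n : nat) (n_gt0 : (0 < n)%N)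
  (Y : completeNormedModType R) (Z : set Y)
  (Z_subspace : submod_closed [in Z]) (Z_closed : closed Z)
  (Y_multi_smooth : forall y : Y, y != 0 -> multi_smooth_finite_order y)
  (LXZ_proximinal : proximinal (@bop_into R (l1 R n) Y Z)) :
  proximinal Z.
Proof.
pose i := Ordinal n_gt0.
pose e : l1 R n := (delta_mx 0 i : 'rV[R]_n).
have coord_lin : linear ((fun x : l1 R n => (x : 'rV[R]_n) 0 i) : _ -> R^o).
  by move=> a x y; rewrite !mxE.
refine (proximinal_bop_into coord_lin (@l1_coord_le R n i) Z (e := e)
  Z_subspace _ _ LXZ_proximinal).
- by rewrite l1_norm_delta.
- by rewrite /e mxE !eqxx.
Qed.
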